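(* The family of dynamic conditional risk mappings $((\rho_t^x)_{t\in\mathbb{N}_0})_{x\in E}$ given, for $Z\in b\mathcal{F}$, by the worst-case risk mapping $$\rho_t^x(Z)=\begin{cases}\mathbb{P}^x\text{-}\operatorname{ess\,sup}(Z),&t=0,\\ \mathbb{P}^x\text{-}\operatorname{ess\,sup}(Z\,\vert\,\mathcal{F}_t),&t\ge1,\end{cases}$$ satisfies the Markov property.
   Context: Setting. $E$ is a Polish space with Borel $\sigma$-algebra $\mathcal{E}$; $\mathbb{N}_0=\{0,1,2,\ldots\}$; $\Omega=E^{\mathbb{N}_0}$; $X_t(\omega)=\omega(t)$ is the coordinate process; $\mathcal{F}_t=\sigma(X_s: s\le t)$ and $\mathcal{F}=\sigma(\bigcup_t\mathcal{F}_t)$. $X$ is a time-homogeneous Markov chain; $x\mapsto\mathbb{P}^x$ is a measurable map from $E$ to the probability measures on $(\Omega,\mathcal{F})$, where $\mathbb{P}^x$ is the law of the chain started at $x$ (so $\mathbb{P}^x(X_0=x)=1$). The shifts $\theta_t:\Omega\to\Omega$ satisfy $X_s\circ\theta_t=X_{t+s}$. $b\mathcal{G}$ denotes the bounded $\mathcal{G}$-measurable real random variables. For $t\ge1$, $\mathbb{P}^x\text{-}\operatorname{ess\,sup}(Z\vert\mathcal{F}_t)$ is the $\mathcal{F}_t$-conditional $\mathbb{P}^x$-essential supremum of $Z$: the smallest $\mathcal{F}_t$-measurable random variable dominating $Z$ $\mathbb{P}^x$-a.s. Risk mapping on $(\Omega,\mathcal{F},\mathbb{P}^x)$: a function $\rho^x:b\mathcal{F}\to\mathbb{R}$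 with $\rho^x(0)=0$; $\rho^x(Z+c)=c+\rho^x(Z)$ for $Z\in b\mathcal{F}$, $c\in\mathbb{R}$; and $Z\le Z'$ $\mathbb{P}^x$-a.s. implies $\rho^x(Z)\le\rho^x(Z')$. Conditional risk mapping on $(\Omega,\mathcal{F},\mathbb{P}^x)$ with respect to $\mathcal{F}_t$: a function $\rho^x_t:b\mathcal{F}\to b\mathcal{F}_t$ with $\rho_t^x(0)=0$ $\mathbb{P}^x$-a.s.; $\rho_t^x(Z+Z')=Z'+\rho_t^x(Z)$ $\mathbb{P}^x$-a.s. for $Z\in b\mathcal{F}$, $Z'\in b\mathcal{F}_t$; and $Z\le Z'$ $\mathbb{P}^x$-a.s. implies $\rho_t^x(Z)\le\rho_t^x(Z')$ $\mathbb{P}^x$-a.s. Dynamic conditional risk mapping on $(\Omega,\mathcal{F},(\mathcal{F}_t),\mathbb{P}^x)$: a sequence $(\rho_t^x)_{t\in\mathbb{N}_0}$ where $\rho_0^x$ is a risk mapping and, for $t\ge1$, $\rho_t^x$ is a conditional risk mapping with respect to $\mathcal{F}_t$. Write $\rho^x:=\rho_0^x$. Regularity: $(\rho^x)_{x\in E}$ is regular if for all $Z\in b\mathcal{F}$ the map $x\mapsto\rho^x(Z)$ is bounded and measurable. Markov property: a family $\varrho=((\rho_t^x)_{t\in\mathbb{N}_0})_{x\in E}$ of dynamic conditional risk mappings satisfies the Markov property (is Markovian) if $(\rho^x_0)_{x\in E}$ is regular and for each $x\in E$, $Z\in b\mathcal{F}$, $t\in\mathbb{N}_0$: $\rho_t^x(Z\circ\theta_t)=\rho^{X_t}(Z)$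 $\mathbb{P}^x$-a.s., where $\rho^{X_t}(Z)$ is $\omega\mapsto\rho^{X_t(\omega)}(Z)$. *)

(* Defs.v *)
From HB Require Import structures.
From mathcomp Require Import all_boot all_order all_algebra.
From mathcomp Require Import all_classical all_reals all_analysis.
From mathcomp Require Import ess_sup_inf.

Set Implicit Arguments.
Unset Strict Implicit.
Unset Printing Implicit Defensive.

Import Order.TTheory GRing.Theory Num.Theory.
Import numFieldNormedType.Exports.

Local Open Scope classical_set_scope.
Local Open Scope ring_scope.

Definition polish (R : realType) (E : topologicalType) : Prop :=
  (exists2 S : set E, countable S & dense S) /\
  exists (M : metricType R) (f : E -> M) (g : M -> E),
    [/\ cancel f g, cancel g f, continuous f, continuous g &
        forall F : set_system M, ProperFilter F -> cauchy F -> exists l : M, F --> l].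

Definition borel (E : ptopologicalType) := g_sigma_algebraType (@open E).

Section path_space.
Variable E : ptopologicalType.

Definition path_coord (t : nat) (w : nat -> E) : E := w t.

Definition path_shift (t : nat) (w : nat -> E) : nat -> E := fun s => w (t + s)%N.

Definition filt (t : nat) : set (set (nat -> E)) :=
  <<s [set A | exists s (B : set (borel E)),
         [/\ (s <= t)%N, measurable B & A = path_coord s @^-1` B]] >>.

Definition path_space := g_sigma_algebraType (\bigcup_t filt t).

End path_space.

Section risk_mappings.
Context d (T : measurableType d) (R : realType).
Implicit Types (P : probability T R) (G : set (set T)) (Z Y : T -> R).

Definition measurable_wrt G Z : Prop :=
  forall B : set R, measurable B -> G (Z @^-1` B).

Definition bmeas G : set (T -> R) :=
  [set Z | measurable_wrt G Z /\ bounded_fun Z].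

Definition is_cond_ess_sup P G Z Y : Prop :=
  [/\ measurable_wrt G Y,
      (\forall w \ae P, Z w <= Y w) &
      forall Y', measurable_wrt G Y' -> (\forall w \ae P, Z w <= Y' w) ->
        \forall w \ae P, Y w <= Y' w].

Definition risk_mapping P (rho : (T -> R) -> R) : Prop :=
  [/\ rho (cst 0) = 0,
      (forall Z c, bmeas measurable Z -> rho (Z \+ cst c) = c + rho Z) &
      forall Z Z', bmeas measurable Z -> bmeas measurable Z' ->
        (\forall w \ae P, Z w <= Z' w) -> rho Z <= rho Z'].

Definition cond_risk_mapping P G (rho : (T -> R) -> (T -> R)) : Prop :=
  [/\ (forall Z, bmeas measurable Z -> bmeas G (rho Z)),
      (\forall w \ae P, rho (cst 0) w = 0),
      (forall Z Z', bmeas measurable Z -> bmeas G Z' ->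
        \forall w \ae P, rho (Z \+ Z') w = Z' w + rho Z w) &
      forall Z Z', bmeas measurable Z -> bmeas measurable Z' ->
        (\forall w \ae P, Z w <= Z' w) ->
        \forall w \ae P, rho Z w <= rho Z' w].

(* The maps of a dynamic family, as total functions meant for bounded
   measurable arguments. The time-0 map is [risk0], which is real valued;
   [risk_cond t] is only meaningful for [0 < t]. *)
Record dynamic_map := DynamicMap {
  risk0 : (T -> R) -> R;
  risk_cond : nat -> (T -> R) -> (T -> R) }.

Definition risk_at (rho : dynamic_map) (t : nat) (Z : T -> R) : T -> R :=
  if t is 0%N then cst (risk0 rho Z) else risk_cond rho t Z.

Definition dynamic_risk_mapping P (F : nat -> set (set T))
    (rho : dynamic_map) : Prop :=
  risk_mapping P (risk0 rho) /\
  forall t, (0 < t)%N -> cond_risk_mapping P (F t) (risk_cond rho t).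

(* Conditional essential suprema are determined only up to null sets, so this
   is a relation: [risk_cond rho t Z] may be any bounded version. *)
Definition worst_case P (F : nat -> set (set T)) (rho : dynamic_map) : Prop :=
  forall Z, bmeas measurable Z ->
    risk0 rho Z = fine (ess_sup P (EFin \o Z)) /\
    forall t, (0 < t)%N ->
      bounded_fun (risk_cond rho t Z) /\
      is_cond_ess_sup P (F t) Z (risk_cond rho t Z).

End risk_mappings.

Section markov.
Context (R : realType) (E : ptopologicalType).
Variable P : borel E -> pprobability (path_space E) R.

(* The last equation is P^x(X_{t+1} \in A | F_t) = q(X_t, A), integrated over
   the events of F_t. *)
Definition markov_chain : Prop :=
  (forall x, P x [set w | path_coord 0 w = x] = 1%E) /\
  exists q : R.-pker borel E ~> borel E,
    forall x t (B : set (path_space E)) (A : set (borel E)),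
      filt t B -> measurable A ->
      P x (B `&` path_coord t.+1 @^-1` A) = (\int[P x]_(w in B) q (path_coord t w) A)%E.

Definition regular (rho : E -> dynamic_map (path_space E) R) : Prop :=
  forall Z, bmeas measurable Z ->
    bmeas (@measurable _ (borel E)) (fun x : borel E => risk0 (rho x) Z).

Definition markov_property (rho : E -> dynamic_map (path_space E) R) : Prop :=
  regular rho /\
  forall x (Z : path_space E -> R) t, bmeas measurable Z ->
    \forall w \ae P x,
      risk_at (rho x) t (Z \o (path_shift t : path_space E -> path_space E)) w = risk0 (rho (path_coord t w)) Z.

End markov.

(* Main.v *)
Require Import Defs.
From mathcomp Require Import all_boot all_order all_algebra.
From mathcomp Require Import all_classical all_reals all_analysis.
From mathcomp Require Import ess_sup_inf.
From mathcomp Require Import measurable_realfun giry lra.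
Import Order.TTheory GRing.Theory Num.Theory.
Import numFieldNormedType.Exports.
Local Open Scope classical_set_scope.
Local Open Scope ring_scope.
Set Implicit Arguments.
Unset Strict Implicit.

(** The one-step Markov property extends to the whole path:
    P^x(B /\ theta_t^-1 A) is the integral of P^(X_t)(A) over B, for every B in
    F_t and every event A (induction on finite cylinders, then uniqueness of
    measures on a pi-system).  Put g(y) = ess sup Z under P^y.  Taking
    A = {Z > g(X_0)}, which is null under every P^y, shows that g(X_t) dominates
    Z o theta_t.  If an F_t-measurable Y' also dominates Z o theta_t, then for
    rational q the event B = {Y' < q < g(X_t)} is null: B does not meet
    {Z o theta_t > q} up to a null set, whereas P^(X_t)(Z > q) > 0 on B.  So
    g(X_t) is the F_t-conditional essential supremum of Z o theta_t. *)

(** * Conditional essential suprema: comparison, uniqueness and existence *)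

Section conditional_ess_sup.
Context d (T : measurableType d) (R : realType).
Implicit Types (G : set (set T)) (Z Y : T -> R).

(** Passing to the measurable type generated by [G] makes the closure lemmas for [measurable_fun]
    available for [G]-measurability. *)
Lemma measurable_wrtP G Z : sigma_algebra setT G ->
  measurable_wrt G Z <-> measurable_fun setT (Z : g_sigma_algebraType G -> R).
Proof.
move=> sG; have EG := measurable_g_measurableTypeE sG.
split=> [mZ _ B mB|mZ B mB]; first by rewrite setTI EG; exact: mZ.
by rewrite -EG -[_ @^-1` _]setTI; exact: (mZ measurableT).
Qed.

Lemma measurable_wrtT Z :
  measurable_wrt measurable Z <-> measurable_fun setT Z.
Proof.
split=> [mZ _ B mB|mZ B mB]; first by rewrite setTI; exact: mZ.
by rewrite -[_ @^-1` _]setTI; exact: (mZ measurableT).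
Qed.

Lemma measurable_wrt_sub G Z : G `<=` measurable ->
  measurable_wrt G Z -> measurable_fun setT Z.
Proof. by move=> sG mZ; apply/measurable_wrtT => B mB; exact/sG/mZ. Qed.

Lemma bounded_fun_exP (Z : T -> R) :
  bounded_fun Z <-> exists M : R, forall w, `|Z w| <= M.
Proof.
split; first move=> [M [_ hM]].
  by exists (M + 1) => w; apply: (hM (M + 1)); rewrite ?ltrDl.
move=> [M hM]; exists M; split; first exact: num_real.
by move=> x Mx w _ /=; rewrite (le_trans (hM w))// ltW.
Qed.

Variable P : probability T R.

Lemma cond_ess_sup_le G Z Z' Y Y' :
  is_cond_ess_sup P G Z Y -> is_cond_ess_sup P G Z' Y' ->
  (\forall w \ae P, Z w <= Z' w) -> \forall w \ae P, Y w <= Y' w.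
Proof.
move=> [_ _ Ymin] [mY' ZY' _] ZZ'; apply: Ymin => //.
by apply: filterS2 ZZ' ZY' => w; exact: le_trans.
Qed.

Lemma cond_ess_sup_unique G Z Y Y' :
  is_cond_ess_sup P G Z Y -> is_cond_ess_sup P G Z Y' ->
  \forall w \ae P, Y w = Y' w.
Proof.
move=> ZY ZY'; have ZZ : \forall w \ae P, Z w <= Z w by exact: nearW.
apply: filterS2 (cond_ess_sup_le ZY ZY' ZZ) (cond_ess_sup_le ZY' ZY ZZ).
by move=> w YY' Y'Y; apply/eqP; rewrite eq_le YY'.
Qed.

(* Among the [G]-measurable functions bounded by [M] and dominating [Z], the
   infimum of a sequence minimising the expectation is a.e. minimal. *)
Lemma cond_ess_sup_exists G Z : sigma_algebra setT G -> G `<=` measurable ->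
  bmeas measurable Z ->
  exists Y, bounded_fun Y /\ is_cond_ess_sup P G Z Y.
Proof.
move=> sG Gm [/measurable_wrtT mZ /bounded_fun_exP[M ZM]].
pose K := [set Y : T -> R | [/\ measurable_wrt G Y, (forall w, `|Y w| <= M) &
  \forall w \ae P, Z w <= Y w]].
(* The shift by [M] makes the integrand nonnegative on [K], so that monotonicity and additivity need
   no integrability conditions. *)
pose I Y := (\int[P]_w (Y w + M)%:E)%E.
have M0 : 0 <= M by rewrite (le_trans _ (ZM point)).
have KM : K (cst M).
  split; first by apply/(measurable_wrtP _ sG); exact: measurable_cst.
    by move=> w; rewrite /= ger0_norm.
  by apply: nearW => w; rewrite (le_trans (ler_norm _)).
have Kge Y w : K Y -> 0 <= Y w + M.
  by move=> [_ /(_ w)]; rewrite ler_norml => /andP[+ _] _; lra.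
have mK Y : K Y -> measurable_fun setT (fun w => (Y w + M : R)%:E).
  move=> [mY _ _]; apply/measurable_EFinP/measurable_funD => //.
  exact: measurable_wrt_sub mY.
have IKne : I @` K !=set0 by exists (I (cst M)); exists (cst M).
have /ereal_inf_seq[u uI ulim] : (I @` K != set0) by exact/set0P.
have /choice[F FK] : forall n, exists Y, K Y /\ I Y = u n.
  by move=> n; have [Y KY IY] := uI n; exists Y.
have Flb w : has_lbound (range (F ^~ w)).
  exists (- M) => _ [n _ <-]; have [[_ /(_ w)]] := FK n.
  by rewrite ler_norml => /andP[].
(* At index 0, [infs] is the infimum of the whole sequence; this form gives [G]-measurability
   through [measurable_fun_infs]. *)
pose Y w := infs (F ^~ w) 0.
have YE w : Y w = inf (range (F ^~ w)).
  rewrite /Y /infs/=; congr inf.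
  by apply/seteqP; split=> [_ [n _ <-]|_ [n _ <-]]; exists n.
have YF n w : Y w <= F n w.
  by rewrite YE; apply: ge_inf => //; exists n.
have Yglb w c : (forall n, c <= F n w) -> c <= Y w.
  move=> cF; rewrite YE; apply: lb_le_inf; first by exists (F 0%N w), 0%N.
  by move=> _ [n _ <-].
have KY : K Y.
  split.
  - apply/(measurable_wrtP _ sG).
    apply: (@measurable_fun_infs _ (g_sigma_algebraType G) R setT F 0%N) => //.
    by move=> n; apply/(measurable_wrtP _ sG); have [[]] := FK n.
  - move=> w; rewrite ler_norml Yglb ?andTb; last first.
      by move=> n; have [[_ /(_ w)]] := FK n; rewrite ler_norml => /andP[].
    rewrite (le_trans (YF 0%N w))//; have [[_ /(_ w)]] := FK 0%N.
    by rewrite ler_norml => /andP[].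
  - have : \forall w \ae P, forall n, Z w <= F n w.
      by apply: ae_foralln => n; have [[]] := FK n.
    by apply: filterS => w ZF; exact: Yglb.
have Imin : forall W, K W -> (I Y <= I W)%E.
  move=> W KW; apply: (@le_trans _ _ (ereal_inf (I @` K))).
    rewrite -(cvg_lim _ ulim)//; apply: lime_ge; first by apply/cvgP: ulim.
    apply: nearW => n; have [KF <-] := FK n.
    apply: ge0_le_integral => //.
    - by move=> w _; rewrite lee_fin Kge.
    - exact: (mK _ KY).
    - exact: (mK _ KF).
    - by move=> w _; rewrite lee_fin lerD2r.
  by apply: ereal_inf_lbound; exists W.
exists Y; split; first by apply/bounded_fun_exP; exists M; have [_ YM _] := KY.
have [mY YM ZY] := KY; split=> // Y' mY' ZY'.
(* The natural competitor is the minimum of [Y] and [Y']. As [Y'] need not be bounded, it is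
   truncated at [- M] to stay in [K]. *)
pose W w := Num.max (- M) (Num.min (Y w) (Y' w)).
have WY w : W w <= Y w.
  rewrite /W ge_max ge_min lexx andbT.
  by have [_ /(_ w)] := KY; rewrite ler_norml => /andP[].
have KW : K W.
  split.
  - apply/(measurable_wrtP _ sG); apply: measurable_maxr => //.
    by apply: measurable_minr; apply/(measurable_wrtP _ sG).
  - move=> w; rewrite ler_norml le_max lexx/= (le_trans (WY w))//.
    by have [_ /(_ w)] := KY; rewrite ler_norml => /andP[].
  - apply: filterS2 ZY ZY' => w ZY ZY'.
    by rewrite le_max le_min ZY ZY' orbT.
have mYW : measurable_fun setT (fun w => (Y w - W w : R)%:E).
  apply/measurable_EFinP/measurable_funB.
    exact: measurable_wrt_sub mY.
  by have [mW _ _] := KW; exact: measurable_wrt_sub mW.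
have IYE : I Y = (I W + \int[P]_w (Y w - W w)%:E)%E.
  rewrite -ge0_integralD//; last 3 first.
  - by move=> w _; rewrite lee_fin Kge.
  - exact: (mK _ KW).
  - by move=> w _; rewrite lee_fin subr_ge0.
  by apply: eq_integral => w _; rewrite -EFinD; congr EFin; lra.
have IWfin : I W \is a fin_num.
  rewrite ge0_fin_numE; last by apply: integral_ge0 => w _; rewrite lee_fin Kge.
  apply: (@le_lt_trans _ _ (\int[P]_w (M + M)%:E)%E).
    apply: ge0_le_integral => //.
    - by move=> w _; rewrite lee_fin Kge.
    - exact: (mK _ KW).
    - move=> w _; rewrite lee_fin lerD2r.
      by have [_ /(_ w)] := KW; rewrite ler_norml => /andP[].
  rewrite integral_cst//=.
  by rewrite (@probability_setT _ _ _ P) mule1 ltry.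
(* [I W] is finite, so [I Y <= I W] and the decomposition [IYE] leave integral 0 for the nonnegative
   function [Y - W]. *)
have D0 : (\int[P]_w `|(Y w - W w)%:E| = 0)%E.
  have -> : (\int[P]_w `|(Y w - W w)%:E| = \int[P]_w (Y w - W w)%:E)%E.
    by apply: eq_integral => w _; rewrite gee0_abs// lee_fin subr_ge0.
  apply/eqP; rewrite eq_le integral_ge0 ?andbT; last first.
    by move=> w _; rewrite lee_fin subr_ge0.
  by have := Imin _ KW; rewrite IYE -{2}(adde0 (I W)) leeD2lE.
have D0ae := proj1 (ae_eq_integral_abs P measurableT mYW) D0.
apply: filterS2 D0ae ZY' => w /(_ Logic.I) [] /eqP.
rewrite subr_eq0 => /eqP -> ZY'w; rewrite /W ge_max ge_min lexx orbT andbT.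
by rewrite (le_trans _ ZY'w)//; have := ZM w; rewrite ler_norml => /andP[].
Qed.

End conditional_ess_sup.

(** * Worst-case families exist and are dynamic conditional risk mappings *)

Section worst_case_risk.
Context d (T : measurableType d) (R : realType).
Implicit Types (G : set (set T)) (Z Y : T -> R) (P : probability T R).

Lemma bmeas_cst G (c : R) : sigma_algebra setT G -> bmeas G (cst c : T -> R).
Proof.
move=> sG; split; first by apply/(measurable_wrtP _ sG); exact: measurable_cst.
by apply/bounded_fun_exP; exists `|c|.
Qed.

Lemma bmeasD G Z Z' : sigma_algebra setT G ->
  bmeas G Z -> bmeas G Z' -> bmeas G (Z \+ Z').
Proof.
move=> sG [mZ /bounded_fun_exP[M ZM]] [mZ' /bounded_fun_exP[M' ZM']]; split.
  by apply/(measurable_wrtP _ sG)/measurable_funD; exact/(measurable_wrtP _ sG).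
apply/bounded_fun_exP; exists (M + M') => w.
by rewrite (le_trans (ler_normD _ _))// lerD.
Qed.

Lemma probability_setT_gt0 P : (0 < P [set: T])%E.
Proof. by rewrite probability_setT. Qed.

Lemma ess_sup_fin_num P Z : bounded_fun Z ->
  ess_sup P (EFin \o Z) \is a fin_num.
Proof.
move=> /bounded_fun_exP[M ZM]; rewrite fin_numElt; apply/andP; split.
  apply: (@lt_le_trans _ _ (- M)%:E); first exact: ltNyr.
  apply: ess_sup_ger => [|w]; first exact: probability_setT_gt0.
  by rewrite lee_fin; have := ZM w; rewrite ler_norml => /andP[].
apply: (@le_lt_trans _ _ M%:E); last exact: ltry.
by apply: ess_sup_ler => w; rewrite lee_fin (le_trans (ler_norm _)).
Qed.

(** Boundedness makes the extended-real essential supremum finite, so [fine] loses nothing.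
    Inequalities for the time-0 map thus become almost sure ones. *)
Lemma fine_ess_sup_leP P Z (c : R) : bounded_fun Z ->
  fine (ess_sup P (EFin \o Z)) <= c <-> \forall w \ae P, Z w <= c.
Proof.
move=> bZ; rewrite -lee_fin fineK ?ess_sup_fin_num//.
by split=> [/ess_supP|/= h]; [|apply/ess_supP].
Qed.

Lemma fine_ess_sup_ge P Z : bounded_fun Z ->
  \forall w \ae P, Z w <= fine (ess_sup P (EFin \o Z)).
Proof. by move=> bZ; exact/fine_ess_sup_leP. Qed.

Variables (P : probability T R) (F : nat -> set (set T)).
Hypothesis sF : forall t, sigma_algebra setT (F t).
Hypothesis Fm : forall t, F t `<=` measurable.

Let sT : sigma_algebra setT (@measurable _ T).
Proof. exact: sigma_algebra_measurable. Qed.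

Lemma worst_case_exists : exists rho : dynamic_map T R, worst_case P F rho.
Proof.
have /choice[Y YP] : forall tZ : nat * (T -> R), exists Y : T -> R,
    bmeas measurable tZ.2 -> bounded_fun Y /\ is_cond_ess_sup P (F tZ.1) tZ.2 Y.
  move=> [t Z]; have [bZ|nbZ] := pselect (bmeas measurable Z); last first.
    (* Nothing is required of functions that are not bounded and measurable; [cst 0] is an arbitrary
       default. *)
    by exists (cst 0) => /nbZ.
  by have [Y YP] := cond_ess_sup_exists P (sF t) (@Fm t) bZ; exists Y.
exists (DynamicMap (fun Z => fine (ess_sup P (EFin \o Z)))
  (fun t Z => Y (t, Z))) => Z bZ; split=> // t _.
exact: (YP (t, Z)).
Qed.

Lemma worst_case_dynamic rho : worst_case P F rho -> dynamic_risk_mapping P F rho.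
Proof.
move=> wc; have wc0 Z bZ := proj1 (wc Z bZ).
split; first split.
- rewrite wc0; last exact: bmeas_cst.
  apply/eqP; rewrite -eqe fineK.
    by apply/eqP/ess_sup_cstr/probability_setT_gt0.
  by apply: ess_sup_fin_num; exact: (bmeas_cst 0 sT).2.
- move=> Z c bZ; have bZc := bmeasD sT bZ (bmeas_cst c sT).
  rewrite !wc0//; apply/eqP; rewrite eq_le; apply/andP; split.
    apply/fine_ess_sup_leP; first exact: bZc.2.
    apply: filterS (fine_ess_sup_ge P bZ.2) => w Zw /=.
    by rewrite addrC lerD2l.
  rewrite -lerBrDl; apply/fine_ess_sup_leP; first exact: bZ.2.
  apply: filterS (fine_ess_sup_ge P bZc.2) => w Zw /=.
  by rewrite lerBrDr.
- move=> Z Z' bZ bZ' ZZ'; rewrite !wc0//; apply/fine_ess_sup_leP; first exact: bZ.2.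
  apply: filterS2 ZZ' (fine_ess_sup_ge P bZ'.2) => w; exact: le_trans.
move=> t t0; have wct Z bZ := (wc Z bZ).2 t t0.
split.
- by move=> Z /wct[bY [mY _ _]].
- have [_ [_ Y0 Ymin]] := wct _ (bmeas_cst 0 sT).
  have Y1 : \forall w \ae P, risk_cond rho t (cst 0) w <= cst 0 w.
    by apply: Ymin; [exact: (bmeas_cst 0 (sF t)).1|exact: nearW].
  by apply: filterS2 Y0 Y1 => w {}Y0 Y1; apply/eqP; rewrite eq_le Y0 Y1.
- move=> Z Z' bZ bZ'.
  have bZ'm : bmeas measurable Z'.
    by split; [move=> B mB; exact/Fm/bZ'.1|exact: bZ'.2].
  have [_ [mY ZY Ymin]] := wct _ bZ.
  have [_ [mX ZX Xmin]] := wct _ (bmeasD sT bZ bZ'm).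
  have mZ' := bZ'.1.
  (* Translation follows from minimality used twice: [Z' + rho Z] dominates [Z + Z'], and, for [YX],
     [rho (Z + Z') - Z'] dominates [Z]; both are [F t]-measurable. *)
  have XY : \forall w \ae P,
      risk_cond rho t (Z \+ Z') w <= Z' w + risk_cond rho t Z w.
    apply: (Xmin (fun w => Z' w + risk_cond rho t Z w)).
      by apply/(measurable_wrtP _ (sF t))/measurable_funD;
        exact/(measurable_wrtP _ (sF t)).
    by apply: filterS ZY => w ZYw /=; rewrite addrC lerD2l.
  have YX : \forall w \ae P,
      risk_cond rho t Z w <= risk_cond rho t (Z \+ Z') w - Z' w.
    apply: (Ymin (fun w => risk_cond rho t (Z \+ Z') w - Z' w)).
      by apply/(measurable_wrtP _ (sF t))/measurable_funB;
        exact/(measurable_wrtP _ (sF t)).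
    by apply: filterS ZX => w ZXw /=; rewrite lerBrDr.
  apply: filterS2 XY YX => w XY YX; apply/eqP; rewrite eq_le XY/=.
  by rewrite -lerBrDl.
- move=> Z Z' bZ bZ'; apply: cond_ess_sup_le; [exact: (wct _ bZ).2|exact: (wct _ bZ').2].
Qed.

End worst_case_risk.

(** * Disintegration identities through the Giry monad *)

Section disintegration.
Context d1 d2 (T1 : measurableType d1) (T2 : measurableType d2) (R : realType).
Local Open Scope ereal_scope.
Variables (mu : giry T1 R) (D : set T1) (mD : measurable D).

Lemma measurable_giry_patch (k : T1 -> giry T2 R) :
  measurable_fun setT k -> measurable_fun setT (k \_ D).
Proof.
move=> mk; apply/(measurable_restrictT _ mD).
exact: measurable_funS mk.
Qed.

(* The point of [giry T2 R] is the zero measure, so [k \_ D] is the kernel [k]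
   killed outside [D]. *)
Lemma giry_int_bind_patch (k : T1 -> giry T2 R)
    (mkD : measurable_fun setT (k \_ D)) (h : T2 -> \bar R) :
  measurable_fun setT h -> (forall z, 0 <= h z) ->
  \int[giry_bind mu mkD]_z h z = \int[mu]_(w in D) \int[k w]_z h z.
Proof.
move=> mh h0; rewrite -[LHS]/(giry_int _ h) giry_int_bind// integral_mkcond.
apply: eq_integral => w _; rewrite /giry_int /patch; case: ifP => // _.
exact: integral_measure_zero.
Qed.

Lemma giry_bind_patchE (k : T1 -> giry T2 R)
    (mkD : measurable_fun setT (k \_ D)) (A : set T2) : measurable A ->
  giry_bind mu mkD A = \int[mu]_(w in D) k w A.
Proof.
move=> mA; rewrite -[A in LHS]setIT -integral_indic// giry_int_bind_patch//.
  by apply: eq_integral => w _; rewrite integral_indic// setIT.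
exact/measurable_EFinP.
Qed.

Variables (g : T1 -> T2) (mg : measurable_fun setT g).

Let mret : measurable_fun setT (giry_ret (R := R) \o g).
Proof. exact: measurableT_comp (@measurable_giry_ret _ T2 R) mg. Qed.

(** Binding with the Dirac masses at [g w], killed outside [D], produces the image under [g] of [mu]
    restricted to [D]. *)
Let giry_bind_ret (A : set T2) : measurable A ->
  giry_bind mu (measurable_giry_patch mret) A = mu (D `&` g @^-1` A).
Proof.
move=> mA; rewrite giry_bind_patchE//.
have mgA : measurable (g @^-1` A) by rewrite -[_ @^-1` _]setTI; exact: mg.
by rewrite setIC -integral_indic.
Qed.

Variables (k : T1 -> giry T2 R) (mk : measurable_fun setT k).

(** Both sides integrate [h] against a bind of [mu], with the Dirac masses at [g w] on the left and
    with [k] on the right; the hypothesis says that these two measures agree. *)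
Lemma ge0_integral_disintegration (h : T2 -> \bar R) :
  (forall A, measurable A -> mu (D `&` g @^-1` A) = \int[mu]_(w in D) k w A) ->
  measurable_fun setT h -> (forall z, 0 <= h z) ->
  \int[mu]_(w in D) h (g w) = \int[mu]_(w in D) \int[k w]_z h z.
Proof.
move=> gk mh h0.
transitivity (\int[giry_bind mu (measurable_giry_patch mret)]_z h z).
  rewrite giry_int_bind_patch//; apply: eq_integral => w _.
  by rewrite -[RHS]/(giry_int (giry_ret (g w)) h) giry_int_ret.
rewrite -(giry_int_bind_patch (measurable_giry_patch mk))//.
apply: eq_measure_integral => A mA _.
by apply: etrans (giry_bind_ret mA) _; rewrite gk//; exact/esym/giry_bind_patchE.
Qed.

(** Both sides are finite measures in [A], hence determined by a generating pi-system that contains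
    the whole space. *)
Lemma disintegration_unique (G : set (set T2)) :
  measurable = <<s G >> -> setI_closed G -> G setT ->
  (forall A, G A -> mu (D `&` g @^-1` A) = \int[mu]_(w in D) k w A) ->
  forall A, measurable A -> mu (D `&` g @^-1` A) = \int[mu]_(w in D) k w A.
Proof.
move=> mG GI GT gk A mA.
rewrite -giry_bind_ret// -(giry_bind_patchE (measurable_giry_patch mk))//.
apply: (measure_unique G (fun=> setT)) => //.
- by rewrite bigcup_const.
- move=> B GB; have mB : measurable B by rewrite mG; exact: sub_sigma_algebra.
  apply: etrans (giry_bind_ret mB) _; rewrite gk//.
  exact/esym/giry_bind_patchE.
- move=> _; apply: (le_lt_trans sprobability_setT).
  exact: ltry.
Qed.

End disintegration.

(** * Filtration, cylinders and shifts on the path space *)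

Section path_space_measurability.
Context (E : ptopologicalType).
Local Notation X := (path_space E).

Lemma filt_sigma_algebra t : sigma_algebra setT (@filt E t).
Proof. exact: smallest_sigma_algebra. Qed.

Lemma filt_measurable t : @filt E t `<=` (measurable : set (set X)).
Proof. by move=> A FA; apply: sub_sigma_algebra; exists t. Qed.

Lemma filt_coord s t (B : set (borel E)) : (s <= t)%N -> measurable B ->
  @filt E t (path_coord s @^-1` B).
Proof. by move=> st mB; apply: sub_sigma_algebra; exists s, B. Qed.

Lemma filt_le s t : (s <= t)%N -> @filt E s `<=` @filt E t.
Proof.
move=> st; apply: smallest_sub; first exact: filt_sigma_algebra.
by move=> _ [r [B [rs mB ->]]]; apply: filt_coord => //; exact: leq_trans st.
Qed.

Lemma filtT t : @filt E t setT.
Proof.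
rewrite -(measurable_g_measurableTypeE (filt_sigma_algebra t)).
exact: measurableT.
Qed.

Lemma filtI t (A B : set (nat -> E)) :
  filt t A -> filt t B -> filt t (A `&` B).
Proof.
rewrite -(measurable_g_measurableTypeE (filt_sigma_algebra t)).
exact: measurableI.
Qed.

Lemma measurable_coord t :
  measurable_fun setT (path_coord t : X -> borel E).
Proof.
by move=> _ B mB; rewrite setTI; apply: (@filt_measurable t); exact: filt_coord.
Qed.

Lemma measurable_wrt_coord (R : realType) t (f : borel E -> R) :
  measurable_fun setT f ->
  @measurable_wrt _ X R (@filt E t) (f \o path_coord t).
Proof.
move=> mf B mB; rewrite comp_preimage; apply: filt_coord => //.
by rewrite -[_ @^-1` _]setTI; exact: mf.
Qed.

(** A full sequence of factors is used, with [setT] from some index on in [cylinders], so that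
    dropping the first factor is a mere shift of the index. *)
Definition cylinder (A : nat -> set (borel E)) : set X :=
  [set w | forall i, A i (w i)].

Definition cylinders : set (set X) :=
  [set cylinder A | A in [set A | (forall i, measurable (A i)) /\
    exists n, forall i, (n <= i)%N -> A i = setT]].

Lemma cylinderE A :
  cylinder A = \bigcap_i (path_coord i : X -> borel E) @^-1` A i.
Proof. by apply/seteqP; split=> [w Aw i _|w Aw i]; exact: Aw. Qed.

Lemma measurable_cylinder A : (forall i, measurable (A i)) ->
  measurable (cylinder A).
Proof.
move=> mA; rewrite cylinderE; apply: bigcapT_measurable => i.
by rewrite -[_ @^-1` _]setTI; exact: measurable_coord.
Qed.

Lemma cylindersI : setI_closed cylinders.
Proof.
move=> _ _ [A [mA [m Am]] <-] [B [mB [n Bn]] <-].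
exists (fun i => A i `&` B i).
  split=> [i|]; first exact: measurableI.
  exists (maxn m n) => i; rewrite geq_max => /andP[mi ni].
  by rewrite Am// Bn// setTI.
apply/seteqP; split=> [w AB|w [Aw Bw] i]; last by split.
by split=> i; have [] := AB i.
Qed.

Lemma cylindersT : cylinders setT.
Proof.
exists (fun=> setT); first by split=> //; exists 0%N.
by apply/seteqP; split.
Qed.

(** A generator X_s in B of the filtration is the cylinder whose only nontrivial factor is at [s].
    This makes the cylinders a pi-system on which laws of paths can be compared. *)
Lemma measurable_pathE : (measurable : set (set X)) = <<s cylinders >>.
Proof.
apply/seteqP; split; last first.
  apply: smallest_sub; first exact: sigma_algebra_measurable.
  by move=> _ [A [mA _] <-]; exact: measurable_cylinder.
apply: smallest_sub; first exact: smallest_sigma_algebra.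
move=> A [t _]; apply: smallest_sub A; first exact: smallest_sigma_algebra.
move=> _ [s [B [st mB ->]]]; apply: sub_sigma_algebra.
exists (fun i => if i == s then B else setT).
  split=> [i|]; first by case: ifP.
  by exists s.+1 => i si; rewrite gtn_eqF.
apply/seteqP; split=> [w /(_ s)|w Bw i]; first by rewrite eqxx.
by case: eqP => // ->.
Qed.

Lemma measurable_shift t :
  measurable_fun setT (path_shift t : X -> X).
Proof.
apply: (measurability cylinders measurable_pathE).
move=> _ [_ [A [mA _] <-] <-]; rewrite setTI cylinderE preimage_bigcap.
apply: bigcapT_measurable => i.
rewrite -[_ @^-1` _]setTI.
exact: (measurable_coord (t + i) measurableT (mA i)).
Qed.

Lemma preimage_shift (A : set X) s t :
  (path_shift t : X -> X) @^-1` ((path_shift s : X -> X) @^-1` A) =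
  (path_shift (t + s) : X -> X) @^-1` A.
Proof.
have -> // : path_shift (t + s) = path_shift s \o path_shift t :> (X -> X).
by apply/funext => w; apply/funext => i; rewrite /path_shift /= addnA.
Qed.

(** Splitting off the coordinate at time 0 is the recursion behind the induction on cylinders. *)
Lemma cylinderS (A : nat -> set (borel E)) :
  cylinder A = (path_coord 0 : X -> borel E) @^-1` A 0%N `&`
    (path_shift 1 : X -> X) @^-1` cylinder (fun i => A i.+1).
Proof.
apply/seteqP; split=> [w Aw|w [A0 AS] [|i]]; last 2 first.
- exact: A0.
- exact: (AS i).
by split=> [|i]; exact: Aw.
Qed.

End path_space_measurability.

(** Singletons are closed because [f] is continuous and injective into a metric space. This makes
    the event X_0 = x measurable. *)
Lemma polish_measurable_set1 (R : realType) (E : ptopologicalType) (x : E) :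
  polish R E -> measurable ([set x] : set (borel E)).
Proof.
move=> [_ [M [f [g [fK _ cf _ _]]]]].
have cx : closed [set x].
  have -> : [set x] = f @^-1` [set f x].
    by apply/seteqP; split=> [y ->//|y /= /(can_inj fK)].
  move: cf => /continuous_closedP; apply.
  apply: accessible_closed_set1.
  exact/hausdorff_accessible/metric_hausdorff.
rewrite -[X in measurable X]setCK; apply: measurableC.
by apply: sub_sigma_algebra; exact: closed_openC.
Qed.

(** * The Markov property of the chain, from one step to the whole path *)

Section markov_property.
Context (R : realType) (E : ptopologicalType).
Variable P : borel E -> pprobability (path_space E) R.
Hypothesis hE : polish R E.
Hypothesis mP : measurable_fun [set: borel E] P.
Hypothesis hP : markov_chain P.
Local Notation X := (path_space E).
Local Open Scope ereal_scope.

Lemma measurable_law (A : set X) :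
  measurable A -> measurable_fun setT (fun y => P y A).
Proof. exact: (measurable_kernel (kprobability mP)). Qed.

Lemma measurable_coord_law t (A : set X) :
  measurable A -> measurable_fun setT (fun w : X => P (path_coord t w) A).
Proof.
move=> mA.
exact: measurableT_comp (measurable_law mA) (@measurable_coord E t).
Qed.

Lemma measurable_giry_law t :
  measurable_fun setT (fun w : X => P (path_coord t w) : giry X R).
Proof. by apply: measurable_giry_codensity => // A; exact: measurable_coord_law. Qed.

Lemma coord0_ae x : \forall w \ae P x, (path_coord 0 : X -> borel E) w = x.
Proof.
have m0 : measurable [set w : X | path_coord 0 w = x].
  have := @measurable_coord E 0 measurableT _ (polish_measurable_set1 x hE).
  by rewrite setTI.
exists (~` [set w : X | path_coord 0 w = x]); split => //.
  exact: measurableC.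
by rewrite probability_setC// hP.1 subee.
Qed.

(* The transition kernel of the chain is the law of [X_1]. *)
Lemma markov_one_step x t (B : set X) (A : set (borel E)) :
  filt t B -> measurable A ->
  P x (B `&` path_coord t.+1 @^-1` A) =
  \int[P x]_(w in B) P (path_coord t w) ((path_coord 1 : X -> borel E) @^-1` A).
Proof.
move=> FB mA; have [_ [q hq]] := hP.
rewrite hq//; apply: eq_integral => w _; move: (path_coord t w) => y.
(* The chain property at time 0, started at [y] and over the whole space, gives P^y(X_1 in A) as the
   integral of q(X_0, A), which is q(y, A) because X_0 = y almost surely. *)
have := hq y 0%N setT A; rewrite setTI => ->//; last first.
  exact: filtT.
rewrite (ae_eq_integral (cst (q y A)))//.
- by rewrite integral_cst//= probability_setT mule1.
- exact: measurableT_comp (measurable_kernel q A mA) (@measurable_coord E 0).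
- by apply: filterS (coord0_ae y) => v /= -> _.
Qed.

(** [markov_one_step] is a disintegration along the kernel [k], the law of X_1 under P^(X_t), so it
    extends from events to nonnegative functions. *)
Lemma integral_one_step x t (B : set X) (h : borel E -> \bar R) :
  filt t B -> measurable_fun setT h -> (forall y, 0 <= h y) ->
  \int[P x]_(w in B) h (path_coord t.+1 w) =
  \int[P x]_(w in B) \int[P (path_coord t w)]_v h (path_coord 1 v).
Proof.
move=> FB mh h0; have mB := filt_measurable FB.
pose k (w : X) : giry (borel E) R :=
  giry_map (@measurable_coord E 1) (P (path_coord t w) : giry X R).
have mk : measurable_fun setT k.
  exact: measurableT_comp (measurable_giry_map _) (@measurable_giry_law t).
have := @ge0_integral_disintegration _ _ X (borel E) R (P x) B mB
  (path_coord t.+1) (@measurable_coord E t.+1) k mk h.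
move=> -> //; last by move=> A mA; exact: markov_one_step.
by apply: eq_integral => w _; exact: giry_int_map.
Qed.

(** As X_0 = x almost surely, the domain of integration is almost everything if [x] lies in [C] and
    null otherwise. *)
Lemma integral_coord0 x (C : set (borel E)) (f : X -> \bar R) :
  measurable C -> measurable_fun setT f -> (forall w, 0 <= f w) ->
  \int[P x]_(w in path_coord 0 @^-1` C) f w = ((fun=> \int[P x]_w f w) \_ C) x.
Proof.
move=> mC mf f0; have m0 : measurable ((path_coord 0 : X -> borel E) @^-1` C).
  by rewrite -[_ @^-1` _]setTI; exact: measurable_coord.
rewrite integral_mkcond /patch; case: ifPn => xC.
  apply: ae_eq_integral => //; first exact/(measurable_restrictT _ m0)/measurable_funTS.
  apply: filterS (coord0_ae x) => w wx _.
  by rewrite ifT// inE/= wx -inE.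
transitivity (\int[P x]_w cst 0 w); last by rewrite integral0.
apply: ae_eq_integral => //; first exact/(measurable_restrictT _ m0)/measurable_funTS.
apply: filterS (coord0_ae x) => w wx _.
by rewrite ifF//; apply/negbTE; move: xC; rewrite !notin_setE/= wx.
Qed.

(** The induction is on the number of possibly constrained coordinates: the first factor is absorbed
    into the event [B], and the remaining cylinder is seen from time t+1. *)
Lemma markov_cylinder n (A : nat -> set (borel E)) :
  (forall i, measurable (A i)) -> (forall i, (n <= i)%N -> A i = setT) ->
  forall x t (B : set X), filt t B ->
  P x (B `&` (path_shift t : X -> X) @^-1` cylinder A) =
  \int[P x]_(w in B) P (path_coord t w) (cylinder A).
Proof.
elim: n A => [|n IHn] A mA An x t B FB; have mB := filt_measurable FB.
  have -> : cylinder A = setT.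
    by apply/seteqP; split=> // w _ i; rewrite An.
  rewrite preimage_setT setIT.
  under eq_integral do rewrite probability_setT.
  by rewrite integral_cst// mul1e.
have mAS i : measurable (A i.+1) by exact: mA.
have {}IHn := IHn (fun i => A i.+1) mAS (fun i ni => An i.+1 ni).
set CS := cylinder (fun i => A i.+1) in IHn *.
have mCS : measurable CS by exact: measurable_cylinder.
pose g y := \int[P y]_v P (path_coord 1 v) CS.
(* Here the induction hypothesis is used at time 1, under P^y and on the event that X_0 lies in the
   first factor. *)
have lawE y : P y (cylinder A) = (g \_ (A 0%N)) y.
  rewrite cylinderS IHn; last exact: filt_coord.
  by rewrite integral_coord0//; exact: measurable_coord_law.
pose B' := B `&` (path_coord t : X -> borel E) @^-1` A 0%N.
have FB' : filt t B' by apply: filtI => //; exact: filt_coord.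
have -> : B `&` (path_shift t : X -> X) @^-1` cylinder A =
    B' `&` (path_shift t.+1 : X -> X) @^-1` CS.
  rewrite cylinderS preimage_setI preimage_shift addn1 setIA.
  congr (_ `&` _ `&` _).
  by apply/seteqP; split=> w; rewrite /preimage/= /path_coord /path_shift addn0.
(* The induction hypothesis at time t+1 leaves P^(X_(t+1))(CS) integrated over [B']. Since [B'] is
   already in F_t, one step back turns the integrand into g(X_t), and [lawE] concludes. *)
rewrite IHn; last exact: filt_le FB'.
rewrite (integral_one_step x FB' (measurable_law mCS))// integral_mkcondr.
by apply: eq_integral => w _; rewrite lawE /patch.
Qed.

Lemma markov_shift x t (B A : set X) : filt t B -> measurable A ->
  P x (B `&` (path_shift t : X -> X) @^-1` A) =
  \int[P x]_(w in B) P (path_coord t w) A.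
Proof.
move=> FB; have mB := filt_measurable FB.
apply: (@disintegration_unique _ _ X X R (P x) B mB (path_shift t)
  (@measurable_shift E t) (fun w => P (path_coord t w) : giry X R)
  (@measurable_giry_law t) (@cylinders E)).
- exact: measurable_pathE.
- exact: cylindersI.
- exact: cylindersT.
- by move=> _ [C [mC [n Cn]] <-]; exact: markov_cylinder Cn _ _ _ FB.
Qed.

End markov_property.

(** * The conditional essential supremum of a shifted variable *)

Section worst_case_markov.
Context (R : realType) (E : ptopologicalType).
Variable P : borel E -> pprobability (path_space E) R.
Hypothesis hE : polish R E.
Hypothesis mP : measurable_fun [set: borel E] P.
Hypothesis hP : markov_chain P.
Local Notation X := (path_space E).

Variables (Z : X -> R) (bZ : bmeas measurable Z).

Let mZ : measurable_fun setT Z. Proof. by apply/measurable_wrtT; exact: bZ.1. Qed.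

Let mZgt (c : R) : measurable (Z @^-1` `]c, +oo[).
Proof. by apply: bZ.1; exact: measurable_itv. Qed.

Let g (y : borel E) : R := fine (ess_sup (P y) (EFin \o Z)).

(** Z <= c almost surely exactly when {Z > c} is null. Both the measurability of [g] and the
    positivity of P^y(Z > q) for q < g(y) come from this. *)
Let g_leP y c : (g y <= c) = (P y (Z @^-1` `]c, +oo[) == 0%E).
Proof.
have ZE : ~` (Z @^-1` `]c, +oo[) = [set w | Z w <= c].
  by rewrite preimage_setC setCitvr; apply/seteqP; split=> w /=; rewrite in_itv.
apply/idP/eqP => [/(fine_ess_sup_leP _ _ bZ.2)[N [mN N0 ZN]]|P0].
  apply: (subset_measure0 _ mN _ N0) => //.
  by apply: subset_trans ZN; rewrite -ZE setCK.
apply/(fine_ess_sup_leP _ _ bZ.2); exists (Z @^-1` `]c, +oo[); split=> //.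
by rewrite -[X in _ `<=` X]setCK ZE.
Qed.

(** By [g_leP], {g > c} is the complement of a level set of the measurable map y -> P^y(Z > c); a
    bound for [Z] also bounds [g]. *)
Lemma bmeas_ess_sup_law : bmeas (@measurable _ (borel E)) g.
Proof.
split.
  apply/measurable_wrtT.
  apply: (measurability _ (RGenOInfty.measurableE R)) => _ [_ [c ->] <-].
  have -> : [set: borel E] `&` g @^-1` `]c, +oo[ =
      ~` ([set: borel E] `&` (fun y => P y (Z @^-1` `]c, +oo[)) @^-1` [set 0%E]).
    rewrite !setTI; apply/seteqP; split=> y /=; rewrite in_itv/= andbT ltNge g_leP.
      by move=> /eqP.
    by move=> /eqP.
  apply: measurableC; apply: (measurable_law mP (mZgt c)) => //.
have /bounded_fun_exP[M ZM] := bZ.2.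
apply/bounded_fun_exP; exists M => y; rewrite ler_norml; apply/andP; split.
  rewrite -lee_fin fineK ?ess_sup_fin_num//; last exact: bZ.2.
  apply: ess_sup_ger => [|w]; first exact: probability_setT_gt0.
  by rewrite lee_fin; have := ZM w; rewrite ler_norml => /andP[].
apply/(fine_ess_sup_leP _ _ bZ.2)/nearW => w.
exact: le_trans (ler_norm _) (ZM w).
Qed.

Lemma cond_ess_sup_shift x t :
  is_cond_ess_sup (P x) (@filt E t)
    (Z \o (path_shift t : X -> X)) (g \o (path_coord t : X -> borel E)).
Proof.
have mg : measurable_fun setT g by apply/measurable_wrtT; exact: bmeas_ess_sup_law.1.
split.
- exact: measurable_wrt_coord.
- pose A := [set v : X | g (path_coord 0 v) < Z v].
  have mA : measurable A.
    have mg0 := measurableT_comp mg (@measurable_coord E 0).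
    have := measurable_fun_ltr mg0 mZ measurableT (Y := [set true]) I.
    by rewrite setTI.
  exists ((path_shift t : X -> X) @^-1` A); split.
  + by rewrite -[_ @^-1` _]setTI; exact: measurable_shift.
  (* With the whole space as conditioning event, the Markov property reduces the claim to P^y(A) = 0
     for each [y]; this holds as X_0 = y and Z <= g(y) almost surely. *)
  + rewrite -[_ @^-1` _]setTI (markov_shift hE mP hP)//; last exact: filtT.
    apply: integral0_eq => w _; move: (path_coord t w) => y.
    have : \forall v \ae P y, ~ A v.
      have ZG := fine_ess_sup_ge (P y) bZ.2.
      apply: filterS2 (coord0_ae hE hP y) ZG => v vy Zv.
      by rewrite /A/= vy; apply/negP; rewrite -leNgt.
    move=> [N [mN N0 AN]]; apply: (subset_measure0 mA mN _ N0).
    by apply: subset_trans AN => v; rewrite /= notK.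
  + move=> w /= /negP; rewrite -ltNge /A/= /path_coord /path_shift addn0.
    exact.
- move=> Y' mY' ZY'.
  pose B (q : rat) := [set w : X | Y' w < ratr q] `&`
    [set w : X | ratr q < g (path_coord t w)].
  have FB q : filt t (B q).
    apply: filtI.
    + have -> : [set w : X | Y' w < ratr q] = Y' @^-1` `]-oo, ratr q[.
        by apply/seteqP; split=> w /=; rewrite in_itv.
      by apply: mY'; exact: measurable_itv.
    + have -> : [set w : X | ratr q < g (path_coord t w)] =
          (path_coord t : X -> borel E) @^-1` (g @^-1` `]ratr q, +oo[).
        by apply/seteqP; split=> w /=; rewrite in_itv/= andbT.
      apply: filt_coord => //; rewrite -[_ @^-1` _]setTI.
      by apply: mg => //; exact: measurable_itv.
  have B0 q : \forall w \ae P x, ~ B q w.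
    have mB := filt_measurable (FB q).
    pose f w := P (path_coord t w) (Z @^-1` `]ratr q, +oo[).
    have mf : measurable_fun (B q) f.
      by apply: measurable_funTS; exact: measurable_coord_law.
    (* By the Markov property the integral is the probability of [B q] together with Z o theta_t >
       q. There Y' < q < Z o theta_t, which happens only on a null set. *)
    have f0 : (\int[P x]_(w in B q) `|f w| = 0)%E.
      under eq_integral do rewrite gee0_abs//.
      rewrite -(markov_shift hE mP hP x (FB q) (mZgt (ratr q))).
      have [N [mN N0 ZN]] := ZY'; apply: (subset_measure0 _ mN _ N0).
        apply: measurableI => //.
        by rewrite -[_ @^-1` _]setTI; exact: measurable_shift.
      move=> w [[Yq _]] /=; rewrite in_itv/= andbT => qZ; apply: ZN => /=.
      by apply/negP; rewrite -ltNge (lt_trans Yq).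
    apply: filterS (proj1 (ae_eq_integral_abs _ mB mf) f0) => w fw0 Bw.
    have /eqP := fw0 Bw.
    by rewrite -g_leP leNgt => /negP; apply; case: Bw.
  (* The rationals are enumerated by [unpickle], so that countably many null sets are discarded at
     once. *)
  have {B0}: \forall w \ae P x, forall n,
      (if unpickle n is Some q then ~ B q w else True).
    by apply: ae_foralln => n; case: unpickle => [q|]; [exact: B0|exact: nearW].
  apply: filterS => w nB /=; rewrite leNgt; apply/negP => Yg.
  have [q] := rat_in_itvoo Yg; rewrite in_itv/= => /andP[Yq qg].
  by have := nB (pickle q); rewrite pickleK; apply; split.
Qed.

End worst_case_markov.

(** * The Markov property of every version of the worst-case family *)

Lemma worst_case_markov (R : realType) (E : ptopologicalType)
    (P : borel E -> pprobability (path_space E) R)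
    (rho : E -> dynamic_map (path_space E) R) :
  polish R E -> measurable_fun [set: borel E] P -> markov_chain P ->
  (forall x, worst_case (P x) (@filt E) (rho x)) -> markov_property P rho.
Proof.
move=> hE mP hP wc; split=> [Z bZ|x Z t bZ].
  have -> : (fun x : borel E => risk0 (rho x) Z) =
      (fun x => fine (ess_sup (P x) (EFin \o Z))).
    by apply/funext => x; exact: (wc x Z bZ).1.
  exact: bmeas_ess_sup_law.
have rhoE y : risk0 (rho y) Z = fine (ess_sup (P y) (EFin \o Z)).
  exact: (wc y Z bZ).1.
case: t => [|t].
  (* [0 + s] computes to [s], so the shift by 0 disappears by conversion and only X_0 = x almost
     surely is needed. *)
  by apply: filterS (coord0_ae hE hP x) => w /= ->.
have bZt : bmeas measurable (Z \o (path_shift t.+1 : path_space E -> path_space E)).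
  split; last first.
    have /bounded_fun_exP[M ZM] := bZ.2.
    by apply/bounded_fun_exP; exists M => w; exact: ZM.
  apply/measurable_wrtT; apply: measurableT_comp (@measurable_shift E t.+1).
  by apply/measurable_wrtT; exact: bZ.1.
(* The chosen version and g(X_t) are both conditional essential suprema of the shifted variable,
   hence equal almost surely. *)
have [_ ess1] := (wc x _ bZt).2 t.+1 isT.
have ess2 := cond_ess_sup_shift hE mP hP bZ x t.+1.
by apply: filterS (cond_ess_sup_unique ess1 ess2) => w /= ->; rewrite rhoE.
Qed.

(** The existence clause ensures that the statement about all versions is not vacuous. *)
Theorem lemma3p2 (R : realType) (E : ptopologicalType)
    (P : borel E -> pprobability (path_space E) R)
    (hE : polish R E)
    (mP : measurable_fun [set: borel E] P)
    (hP : markov_chain P) :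
  (exists rho : E -> dynamic_map (path_space E) R,
     forall x, worst_case (P x) (@filt E) (rho x)) /\
  forall rho : E -> dynamic_map (path_space E) R,
    (forall x, worst_case (P x) (@filt E) (rho x)) ->
    (forall x, dynamic_risk_mapping (P x) (@filt E) (rho x)) /\
    markov_property P rho.
Proof.
split=> [|rho wc].
  have /choice[rho rhoP] : forall x, exists rho : dynamic_map (path_space E) R,
      worst_case (P x) (@filt E) rho.
    move=> x; apply: worst_case_exists => t; first exact: filt_sigma_algebra.
    exact: filt_measurable.
  by exists rho.
split; last exact: worst_case_markov.
move=> x; apply: worst_case_dynamic (wc x) => t; first exact: filt_sigma_algebra.
exact: filt_measurable.
Qed.
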